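(* For every integer $k\geq 0$, with $\boldsymbol{E}_k$ and $\mathcal{L}_i$ as in the context, $$\boldsymbol{E}_k=(1-\mathcal{L}_{k-1}\tau)(1-\mathcal{L}_{k-2}\tau)\cdots(1-\mathcal{L}_{0}\tau)\quad\text{in } K^{d\times d}[\tau].$$
   Context: Let $\mathbb{F}_q$ be a finite field with $q$ elements and characteristic $p$, $A=\mathbb{F}_q[\theta]$, $K=\mathbb{F}_q(\theta)$. For $c\in K$ put $c^{(k)}=c^{q^k}$ and for a matrix $M$ apply this entrywise to get $M^{(k)}$. $K^{d\times d}[\tau]$ is the ring of finite sums $\sum_iM_i\tau^i$ with $M_i\in K^{d\times d}$ and multiplication determined by $\tau M=M^{(1)}\tau$. Fix $d\ge1$; $e_{i,j}$ is the elementary $d\times d$ matrix, $N=\sum_{i=1}^{d-1}e_{i,i+1}$, $C^{\otimes d}_\theta=\theta+N+e_{d,1}\tau$. Let $\exp_{C^{\otimes d}}=\sum_{i\ge0}Q_i\tau^i$ be the unique series in $K^{d\times d}[[\tau]]$ with $Q_0=1$ and $\exp_{C^{\otimes d}}(\theta+N)=C^{\otimes d}_\theta\exp_{C^{\otimes d}}$. For a field $F$ and indeterminate $x$, $\mathcal{D}_{x,j}$ denote the Hasse–Schmidt derivatives on $F(x)$ ($\mathcal{D}_{x,j}(x^i)=\binom ij x^{i-j}$), other indeterminates being treated as constants. Put $\boldsymbol{d}_x(f)=\sum_{i=0}^{d-1}\mathcal{D}_{x,i}(f)N^i$ and, for $f\in F(x,z)$, $\boldsymbol{\Delta}_{x,z}(f)$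 the $d\times d$ matrix with $(i,j)$-entry $\mathcal{D}_{x,d-i}(\mathcal{D}_{z,j-1}(f))$. Let $f_d(x,y,z)=\sum_{j=0}^{d-1}(z-y)^j(x-y)^{d-1-j}$ (mod $p$). Define $\Gamma_k:=\boldsymbol{d}_x\big((x-\theta^q)\cdots(x-\theta^{q^k})\big)^{-d}\big|_{x=\theta}\in\mathrm{GL}_d(K)$ (so $\Gamma_0=1$), and $$\boldsymbol{E}_k:=\Gamma_k^{-1}\sum_{j=0}^kQ_j\big(\Gamma_{k-j}\big)^{(j)}\tau^j\in K^{d\times d}[\tau].$$ For $i\geq0$ let $$\mathcal{L}_i:=\boldsymbol{\Delta}_{x,z}\left(f_d(x,y,z)\Big(\frac{(x-\theta^q)\cdots(x-\theta^{q^i})}{(z-\theta^{q^2})\cdots(z-\theta^{q^{i+1}})}\Big)^d\right)\Bigg|_{x=\theta,\ y=\theta^{q^{i+1}},\ z=\theta^q}.$$ Empty products equal $1$. *)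

(* Defs.v *)
From Stdlib Require Import ClassicalEpsilon.
From HB Require Import structures.
From mathcomp Require Import all_boot all_order all_algebra pgroup finfield zify.
From mathcomp Require Import generic_quotient bigenough.
From mathcomp.multinomials Require Import ssrcomplements freeg mpoly.

Set Implicit Arguments.
Unset Strict Implicit.
Unset Printing Implicit Defensive.

Import GRing.Theory BigEnough.
Local Open Scope ring_scope.
Local Open Scope quotient_scope.

Notation "x %:F" := (@FracField.tofrac _ x) (format "x %:F") : ring_scope.

(* The skew product of (the coefficient sequences of) two series
   sum_i f_i tau^i and sum_i g_i tau^i, subject to tau * a = sigma(a) * tau. *)
Definition skew_mul (R : nzRingType) (sigma : R -> R) (f g : nat -> R) : nat -> R :=
  fun n => \sum_(i < n.+1) f i * iter i sigma (g (n - i)%N).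

(* R[tau; sigma]: same additive group as {poly R}, twisted multiplication. *)
Definition skewpoly (R : nzRingType) (sigma : {rmorphism R -> R}) : Type := {poly R}.

Section SkewPoly.
Variables (R : nzRingType) (sigma : {rmorphism R -> R}).
Local Notation S := (skewpoly sigma).

HB.instance Definition _ := GRing.Zmodule.copy S {poly R}.

Definition skewcoef (f : S) : nat -> R := fun i => (f : {poly R})`_i.
Definition skewC (a : R) : S := a%:P.
Definition tau : S := ('X : {poly R}).

Definition skewpoly_mul (f g : S) : S :=
  \poly_(i < size (f : {poly R}) + size (g : {poly R}))
     skew_mul sigma (skewcoef f) (skewcoef g) i.

Lemma skewpolyP (f g : S) : skewcoef f =1 skewcoef g -> f = g.
Proof. by move=> e; apply/polyP => i; apply: e. Qed.

Let iters0 k : iter k sigma 0 = 0.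
Proof. by elim: k => //= k ->; rewrite rmorph0. Qed.
Let iters1 k : iter k sigma 1 = 1.
Proof. by elim: k => //= k ->; rewrite rmorph1. Qed.
Let itersD k a b : iter k sigma (a + b) = iter k sigma a + iter k sigma b.
Proof. by elim: k => //= k ->; rewrite rmorphD. Qed.
Let itersM k a b : iter k sigma (a * b) = iter k sigma a * iter k sigma b.
Proof. by elim: k => //= k ->; rewrite rmorphM. Qed.
Let iters_sum k (I : Type) (r : seq I) (F : I -> R) :
  iter k sigma (\sum_(i <- r) F i) = \sum_(i <- r) iter k sigma (F i).
Proof.
by elim: r => [|i r IH]; rewrite ?big_nil ?iters0 // !big_cons itersD IH.
Qed.

Lemma skewcoefD (f g : S) i : skewcoef (f + g) i = skewcoef f i + skewcoef g i.
Proof. exact: coefD. Qed.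

Lemma skewcoefC a i : skewcoef (skewC a) i = if i == 0 then a else 0.
Proof. exact: coefC. Qed.

Lemma skewcoefM_def (f g : S) i :
  skewcoef (skewpoly_mul f g) i = skew_mul sigma (skewcoef f) (skewcoef g) i.
Proof.
rewrite /skewcoef /skewpoly_mul coef_poly; case: ltnP => // le_i.
rewrite /skew_mul big1 // => j _.
have [lt_j|le_j] := ltnP j (size (f : {poly R})); last first.
  by rewrite nth_default ?mul0r.
rewrite [X in iter _ _ X]nth_default ?iters0 ?mulr0 //.
rewrite leq_subRL -1?ltnS //; apply: leq_trans _ le_i.
by rewrite leq_add2r ltnW.
Qed.

Let mulA : associative skewpoly_mul.
Proof.
move=> f g h; apply: skewpolyP => n; rewrite !skewcoefM_def /skew_mul.
pose F i j := skewcoef f i * iter i sigma (skewcoef g j)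
                * iter (i + j) sigma (skewcoef h (n - (i + j))).
transitivity (\sum_(i < n.+1) \sum_(j < n.+1 | (i + j <= n)%N) F i j).
  apply: eq_bigr => i _; rewrite skewcoefM_def /skew_mul iters_sum mulr_sumr.
  rewrite (big_ord_widen_cond n.+1 xpredT
             (fun j => skewcoef f i * iter i sigma
                (skewcoef g j * iter j sigma (skewcoef h (n - i - j))))); last first.
    by rewrite ltnS leq_subr.
  apply: eq_big => [j|j _]; first by rewrite ltnS leq_subRL // -ltnS.
  by rewrite /F itersM -iterD subnDA mulrA.
have -> : \sum_(i < n.+1) skewcoef (skewpoly_mul f g) i
              * iter i sigma (skewcoef h (n - i))
        = \sum_(m < n.+1) \sum_(i < n.+1 | (i <= m)%N) F i (m - i)%N.
  apply: eq_bigr => m _; rewrite skewcoefM_def /skew_mul mulr_suml.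
  rewrite (big_ord_widen_cond n.+1 xpredT
             (fun i => skewcoef f i * iter i sigma (skewcoef g (m - i)) *
                iter m sigma (skewcoef h (n - m)))) //.
  apply: eq_big => [j|j]; first by rewrite ltnS.
  by rewrite ltnS /F => le_jm; rewrite subnKC.
rewrite [RHS](exchange_big_dep xpredT) //=; apply: eq_bigr => i _.
have le_in : (i <= n)%N by rewrite -ltnS.
transitivity (\sum_(0 <= j < n.+1 | (i + j <= n)%N) F i j); first by rewrite big_mkord.
transitivity (\sum_(0 <= m < n.+1 | (i <= m)%N) F i (m - i)%N); last by rewrite big_mkord.
rewrite [RHS](big_cat_nat _ (n := i)) //=; last by rewrite ltnW.
rewrite [X in _ = X + _]big_nat_cond [X in _ = X + _]big_pred0 ?add0r; last first.
  by move=> m /=; rewrite [(i <= m)%N]leqNgt andbN.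
rewrite -[X in _ = \sum_(X <= _ < _ | _) _]add0n big_addn.
rewrite [LHS](big_cat_nat _ (n := n.+1 - i)) ?leq_subr //=.
rewrite [X in _ + X = _]big_nat_cond [X in _ + X = _]big_pred0 ?addr0; last first.
  move=> m; apply/negP => /andP[/andP[]]; rewrite leq_subLR => h1 _ h2.
  by rewrite ltnNge h2 in h1.
rewrite big_nat_cond [RHS]big_nat_cond; apply: eq_big => [j|j _]; last by rewrite addnK.
rewrite leq_addl andbT; case: ltnP => //= lt_j; rewrite ?andbF //.
by rewrite -ltnS -ltn_subRL.
Qed.

Let mul1 : left_id (skewC 1) skewpoly_mul.
Proof.
move=> f; apply: skewpolyP => n; rewrite skewcoefM_def /skew_mul big_ord_recl.
rewrite skewcoefC /= mul1r subn0 big1 ?addr0 // => i _.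
by rewrite skewcoefC mul0r.
Qed.

Let mulr1' : right_id (skewC 1) skewpoly_mul.
Proof.
move=> f; apply: skewpolyP => n; rewrite skewcoefM_def /skew_mul big_ord_recr /=.
rewrite subnn skewcoefC /= iters1 mulr1 big1 ?add0r // => i _.
by rewrite skewcoefC subn_eq0 leqNgt ltn_ord /= iters0 mulr0.
Qed.

Let mulDl : left_distributive skewpoly_mul +%R.
Proof.
move=> f g h; apply: skewpolyP => n; rewrite skewcoefD !skewcoefM_def /skew_mul.
by rewrite -big_split /=; apply: eq_bigr => i _; rewrite skewcoefD mulrDl.
Qed.

Let mulDr : right_distributive skewpoly_mul +%R.
Proof.
move=> f g h; apply: skewpolyP => n; rewrite skewcoefD !skewcoefM_def /skew_mul.
by rewrite -big_split /=; apply: eq_bigr => i _; rewrite skewcoefD itersD mulrDr.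
Qed.

Let one_neq0 : skewC 1 != 0 :> S.
Proof. exact: oner_neq0. Qed.

HB.instance Definition _ := GRing.Zmodule_isNzRing.Build S
  mulA mul1 mulr1' mulDl mulDr one_neq0.

Lemma skewcoefM (f g : S) i :
  skewcoef (f * g) i = skew_mul sigma (skewcoef f) (skewcoef g) i.
Proof. exact: skewcoefM_def. Qed.

Lemma tau_skewC a : tau * skewC a = skewC (sigma a) * tau :> S.
Proof.
apply: skewpolyP => n; rewrite !skewcoefM /skew_mul.
rewrite [RHS]big_ord_recl [X in _ = _ + X]big1 ?addr0; last first.
  by move=> i _; rewrite skewcoefC mul0r.
rewrite skewcoefC /= subn0 /tau /skewcoef coefX; case: n => [|n].
  by rewrite big_ord1 coefX mul0r mulr0.
rewrite 2!big_ord_recl big1 ?addr0 => [|i _]; last by rewrite coefX mul0r.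
by rewrite !coefX mul0r add0r mul1r coefC /= subSS subn0; case: n => [|n];
  rewrite /= ?rmorph0 ?mulr1 ?mulr0.
Qed.

End SkewPoly.

Arguments skewC {R sigma} a.
Arguments tau {R sigma}.

Section FractionTools.
Variable R : idomainType.
Local Notation F := {fraction R}.

(* The values c_0, ..., c_(j-1) of the solution of
   sum_(i <= l) b_(l-i) c_i = a_l, i.e. the coefficients of the quotient of the
   power series sum_l a_l T^l by sum_l b_l T^l. *)
Fixpoint quo_series_seq (a b : nat -> F) (j : nat) : seq F :=
  if j is l.+1 then
    let s := quo_series_seq a b l in
    rcons s ((a l - \sum_(i < l) b (l - i)%N * s`_i) / b 0%N)
  else [::].

Definition quo_series (a b : nat -> F) (j : nat) : F := (quo_series_seq a b j.+1)`_j.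

(* The extension to Frac(R) of a higher derivation (D_j)_j of R, by the
   quotient rule sum_(i <= j) D_(j-i)(v) D_i(u/v) = D_j(u). *)
Definition frac_hasse (D : nat -> R -> R) (j : nat) (f : F) : F :=
  quo_series (fun i => (D i \n_(repr f))%:F) (fun i => (D i \d_(repr f))%:F) j.

(* [frac_eval phi f] is phi(u)/phi(v) for any writing f = u/v with phi(v) != 0;
   the representative chosen by [repr] need not have that property.  It is
   unspecified when f has no such writing. *)
Definition frac_eval (L : fieldType) (phi : R -> L) (f : F) : L :=
  epsilon (inhabits 0) (fun c => exists u v,
    [/\ phi v != 0, f = u%:F / v%:F & c = phi u / phi v]).

Lemma frac_evalE (L : fieldType) (phi : {rmorphism R -> L}) u v : phi v != 0 ->
  frac_eval phi (u%:F / v%:F) = phi u / phi v.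
Proof.
move=> v0; rewrite /frac_eval.
set P := fun c => _; have /epsilon_spec : exists c, P c.
  by exists (phi u / phi v), u, v.
move=> /(_ (inhabits 0)) [u' [v' [v'0 + ->]]].
have nz w : phi w != 0 -> w%:F != 0 :> F.
  by rewrite tofrac_eq0; apply: contraNneq => ->; rewrite rmorph0.
move/eqP; rewrite eqr_div ?nz // -!tofracM tofrac_eq => /eqP /(congr1 phi).
by rewrite !rmorphM => e; apply/eqP; rewrite eqr_div // e.
Qed.

Lemma size_quo_series_seq a b j : size (quo_series_seq a b j) = j.
Proof. by elim: j => //= j IH; rewrite size_rcons IH. Qed.

Lemma nth_quo_series_seq a b j i :
  (i < j)%N -> (quo_series_seq a b j)`_i = quo_series a b i.
Proof.
elim: j => // j IH; rewrite ltnS leq_eqVlt => /predU1P[->//|lt_ij].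
by rewrite /= nth_rcons size_quo_series_seq lt_ij IH.
Qed.

Lemma quo_seriesP a b j : b 0%N != 0 ->
  \sum_(i < j.+1) b (j - i)%N * quo_series a b i = a j.
Proof.
move=> b0; rewrite big_ord_recr /= subnn {2}/quo_series /=.
rewrite nth_rcons size_quo_series_seq ltnn eqxx mulrC divfK //.
rewrite addrC -[RHS](subrK (\sum_(i < j) b (j - i)%N * quo_series a b i)).
by congr (_ - _ + _); apply: eq_bigr => i _; rewrite nth_quo_series_seq.
Qed.

Lemma frac_numden (f : F) : f * (\d_(repr f))%:F = (\n_(repr f))%:F.
Proof.
rewrite -{1}[f]reprK; move: (repr f) => r.
rewrite !piE; apply/eqmodP; rewrite /= FracField.equivfE /FracField.mulf.
rewrite !numden_Ratio ?mulf_neq0 ?oner_neq0 ?denom_ratioP //.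
by rewrite !mulr1 mulrC.
Qed.

Let conv (a b : nat -> F) n : F := \sum_(i < n.+1) b (n - i)%N * a i.

Let convE a b j n : (n <= j)%N ->
  conv a b n = ((\poly_(i < j.+1) a i) * (\poly_(i < j.+1) b i))`_n.
Proof.
move=> le_nj; rewrite coefM; apply: eq_bigr => i _.
have le_in : (i <= n)%N by rewrite -ltnS.
rewrite !coef_poly !ltnS (leq_trans le_in le_nj).
by rewrite (leq_trans (leq_subr _ _) le_nj) mulrC.
Qed.

Let conv_poly a (b : {poly F}) j n : (n <= j)%N ->
  conv a (fun i => b`_i) n = ((\poly_(i < j.+1) a i) * b)`_n.
Proof.
move=> le_nj; rewrite coefM; apply: eq_bigr => i _.
have le_in : (i <= n)%N by rewrite -ltnS.
by rewrite !coef_poly !ltnS (leq_trans le_in le_nj) mulrC.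
Qed.

Let eq_conv a b b' n : {in gtn n.+1, b =1 b'} -> conv a b n = conv a b' n.
Proof. by move=> e; apply: eq_bigr => i _; rewrite e // inE ltnS leq_subr. Qed.

Let convC a b : conv a b =1 conv b a.
Proof. by move=> n; rewrite !(convE _ _ (leqnn n)) mulrC. Qed.

Let convCA a b c : conv a (conv b c) =1 conv b (conv a c).
Proof.
move=> n; pose P (u : nat -> F) := \poly_(i < n.+1) u i.
transitivity ((P a * (P b * P c))`_n); last rewrite mulrCA.
  rewrite -conv_poly //; apply: eq_conv => i; rewrite inE ltnS => le_in.
  exact: convE.
symmetry; rewrite -conv_poly //; apply: eq_conv => i; rewrite inE ltnS => le_in.
exact: convE.
Qed.

Let conv_inj a b c : a 0%N != 0 -> conv a b =1 conv a c -> b =1 c.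
Proof.
move=> a0 e n; elim/ltn_ind: n => n IH.
have := e n; rewrite ![conv a _ n]convC /conv !big_ord_recr /= subnn.
rewrite (eq_bigr (fun i : 'I_n => a (n - i)%N * c i)); last by move=> i _; rewrite IH.
by move/addrI/(mulfI a0).
Qed.

(* The quotient rule holds for every way of writing a fraction, provided that
   (D_j)_j is a higher derivation. *)
Lemma frac_hasse_quotient (D : nat -> R -> R) :
    D 0%N =1 id ->
    (forall j u v, D j (u * v) = \sum_(i < j.+1) D (j - i)%N u * D i v) ->
  forall u v, v != 0 -> forall j,
    \sum_(i < j.+1) (D (j - i)%N v)%:F * frac_hasse D i (u%:F / v%:F) = (D j u)%:F.
Proof.
move=> D0 DM u v v0; set f := u%:F / v%:F; set c := frac_hasse D ^~ f.
pose E w i : F := (D i w)%:F; pose n := \n_(repr f); pose m := \d_(repr f).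
have m0 : m != 0 by apply: denom_ratioP.
have EM x y : conv (E y) (E x) =1 E (x * y).
  move=> j; rewrite /E DM rmorph_sum /=.
  by apply: eq_bigr => i _; rewrite rmorphM.
have cm : conv c (E m) =1 E n.
  by move=> j; apply: (@quo_seriesP (E n) (E m)); rewrite /E D0 tofrac_eq0.
have nv : v * n = m * u.
  have fE : f = n%:F / m%:F.
    by apply: (canRL (mulfK _)); rewrite ?tofrac_eq0 // frac_numden.
  move/eqP: fE; rewrite /f eqr_div ?tofrac_eq0 // -!tofracM tofrac_eq => /eqP.
  by rewrite mulrC [n * v]mulrC.
apply: (@conv_inj (E m)); first by rewrite /E D0 tofrac_eq0.
move=> j; rewrite (@eq_conv _ _ (conv (E v) c)); last by move=> i _; apply: convC.
rewrite convCA (@eq_conv _ _ (E n)); last by move=> i _; rewrite convC cm.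
by rewrite convC !EM nv mulrC.
Qed.

End FractionTools.

(* D_{i,j} on polynomials in several variables:
   X_i^m * (other variables) |-> binom(m, j) X_i^(m-j) * (other variables). *)
Definition mhasse (R : nzRingType) (n : nat) (i : 'I_n) (j : nat)
    (p : {mpoly R[n]}) : {mpoly R[n]} :=
  \sum_(m <- msupp p) (p@_m *+ 'C(m i, j)) *: 'X_[(m - U_(i) *+ j)%MM].

Lemma nderivnM (R : comNzRingType) j (u v : {poly R}) :
  (u * v)^`N(j) = \sum_(i < j.+1) u^`N(j - i) * v^`N(i).
Proof.
elim/poly_ind: u j => [|u c IH] j.
  by rewrite mul0r linear0 big1 // => i _; rewrite linear0 mul0r.
have DMX k (w : {poly R}) : (w * 'X)^`N(k.+1) = w^`N(k) + w^`N(k.+1) * 'X.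
  by rewrite -(nderivnMXaddC _ _ 0) polyC0 addr0.
have DC w : (c%:P * w)^`N(j) = c%:P * w^`N(j) by rewrite !mul_polyC linearZ.
rewrite mulrDl mulrAC linearD /= DC.
case: j DC => [|j] DC.
  by rewrite big_ord1 !nderivn0 mulrDl mulrAC.
rewrite DMX !IH [RHS]big_ord_recr /= subnn nderivn0 mulrDl addrA; congr (_ + _).
rewrite [X in _ + X * _]big_ord_recr /= subnn nderivn0 mulrDl addrA mulrAC.
congr (_ + _).
rewrite mulr_suml -big_split /=; apply: eq_bigr => i _.
by rewrite subSn -1?ltnS // nderivnMXaddC mulrDl mulrAC.
Qed.

Section MultiHasse.
Variables (R : comNzRingType) (n : nat) (i : 'I_n).

Lemma mhassewE j (p : {mpoly R[n]}) k : (msize p <= k)%N ->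
  mhasse i j p = \sum_(m : 'X_{1..n < k}) (p@_m *+ 'C(m i, j)) *: 'X_[(m - U_(i) *+ j)%MM].
Proof.
pose I : subFinType _ := 'X_{1..n < k}.
move=> le_pk; rewrite /mhasse (big_mksub I) /=; first last.
- by move=> x /msize_mdeg_lt/leq_trans/(_ le_pk).
- by rewrite msupp_uniq.
by rewrite big_rmcond //= => m /memN_msupp_eq0 ->; rewrite mul0rn scale0r.
Qed.

Lemma mhasse_is_linear j : linear (@mhasse R n i j).
Proof.
move=> c p q; pose_big_enough k; first rewrite !(@mhassewE j _ k) //.
  rewrite scaler_sumr -big_split /=; apply/eq_bigr=> m _.
  by rewrite !scalerA -scalerDl mcoeffD mcoeffZ mulrnDl mulrnAr.
by close.
Qed.

HB.instance Definition _ j := GRing.isLinear.Build R {mpoly R[n]} {mpoly R[n]}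
  _ (@mhasse R n i j) (mhasse_is_linear j).

Lemma mhasseX j m :
  mhasse i j 'X_[m] = 'X_[R, (m - U_(i) *+ j)%MM] *+ 'C(m i, j).
Proof. by rewrite /mhasse msuppX big_seq1 mcoeffX eqxx scaler_nat. Qed.

Lemma mhasse0 : @mhasse R n i 0 =1 id.
Proof.
move=> p; rewrite {2}[p]mpolyE; apply: eq_bigr => m _.
rewrite bin0; congr (_ *: 'X_[_]).
by apply/mnmP => l; rewrite mnmBE mulmnE muln0 subn0.
Qed.

Lemma mhasseM j (u v : {mpoly R[n]}) :
  mhasse i j (u * v) = \sum_(l < j.+1) mhasse i (j - l) u * mhasse i l v.
Proof.
elim/mpolyind: u => [|c a u _ _ IH].
  by rewrite mul0r linear0 big1 // => l _; rewrite linear0 mul0r.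
rewrite mulrDl linearD /= IH -scalerAl linearZ /=.
rewrite [RHS](eq_bigr (fun l : 'I_j.+1 => c *: (mhasse i (j - l) 'X_[a] * mhasse i l v)
    + mhasse i (j - l) u * mhasse i l v)); last first.
  by move=> l _; rewrite linearD linearZ /= mulrDl scalerAl.
rewrite big_split /=; congr (_ + _); rewrite -scaler_sumr; congr (_ *: _).
elim/mpolyind: v {IH} => [|e b v _ _ IH].
  by rewrite mulr0 linear0 big1 // => l _; rewrite linear0 mulr0.
rewrite mulrDr linearD /= IH -scalerAr linearZ /=.
rewrite [RHS](eq_bigr (fun l : 'I_j.+1 => e *: (mhasse i (j - l) 'X_[a] * mhasse i l 'X_[b])
    + mhasse i (j - l) 'X_[a] * mhasse i l v)); last first.
  by move=> l _; rewrite linearD linearZ /= mulrDr scalerAr.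
rewrite big_split /=; congr (_ + _); rewrite -scaler_sumr; congr (_ *: _).
rewrite -mpolyXD mhasseX mnmDE [(a i + b i)%N]addnC -binomial.Vandermonde -sumrMnr; apply: eq_bigr => l _.
rewrite !mhasseX mulrnAl mulrnAr -mulrnA.
have [lt_a|le_a] := ltnP (a i) (j - l); first by rewrite (bin_small lt_a) muln0 !mulr0n.
have [lt_b|le_b] := ltnP (b i) l; first by rewrite (bin_small lt_b) mul0n !mulr0n.
rewrite -mpolyXD; congr ('X_[_] *+ _); apply/mnmP => s.
rewrite !(mnmBE, mnmDE, mulmnE, mnm1E); case: eqP => [<-|_]; rewrite ?mul0n ?subn0 //.
rewrite !mul1n; have le_l : (l <= j)%N by rewrite -ltnS.
by rewrite addnBAC // addnBA // -subnDA ?subnK ?subnKC.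
Qed.
End MultiHasse.

Section Matrices.
(* Matrices have size d'.+1, so that they form a nontrivial ring. *)
Variable d' : nat.

Definition nilN (R : nzRingType) : 'M[R]_d'.+1 :=
  \matrix_(i, j) (j == i.+1 :> nat)%:R.

Definition bd (F : fieldType) (f : {fraction {poly F}}) : 'M[{fraction {poly F}}]_d'.+1 :=
  \sum_(i < d'.+1)
    frac_hasse (fun j (p : {poly F}) => p^`N(j)) i f *: nilN _ ^+ i.

(* Rows and columns are counted from 0, hence the orders d' - i and j. *)
Definition bDelta (F : fieldType) (n : nat) (x z : 'I_n)
    (f : {fraction {mpoly F[n]}}) : 'M[{fraction {mpoly F[n]}}]_d'.+1 :=
  \matrix_(i, j) frac_hasse (mhasse x) (d' - i) (frac_hasse (mhasse z) j f).

End Matrices.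

Section Nilpotent.
Variables (F : fieldType) (d' : nat).
Local Notation N := (nilN d' F).

Lemma nilN_exp k (i j : 'I_d'.+1) : (N ^+ k) i j = (j == (i + k)%N :> nat)%:R.
Proof.
elim: k i j => [|k IH] i j; first by rewrite expr0 mxE addn0 eq_sym.
rewrite exprSr mxE (eq_bigr (fun l : 'I_d'.+1 => (l == (i + k)%N :> nat)%:R * (j == l.+1 :> nat)%:R)).
  have [lt_ik|le_ik] := ltnP (i + k) d'.+1; last first.
    rewrite big1 => [|l _]; last first.
      by have := ltn_ord l; case: eqP => /= [|_ _]; [lia | rewrite mul0r].
    by have := ltn_ord j; case: eqP => //=; lia.
  rewrite (bigD1 (Ordinal lt_ik)) //= eqxx mul1r addnS big1 ?addr0 // => l.
  by rewrite -val_eqE /= => /negbTE ->; rewrite mul0r.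
by move=> l _; rewrite IH !mxE.
Qed.

Lemma nilN_sylvester (a b : F) (X : 'M[F]_d'.+1) : b - a != 0 ->
  X * (b%:M + N) = (a%:M + N) * X -> X = 0.
Proof.
move=> ab0 e; set c := b - a in ab0.
have e1 : N * X = X * (N + c%:M).
  move: e; rewrite !mulrDl !mulrDr -!mulmxE !mul_mx_scalar !mul_scalar_mx => e.
  by rewrite /c scalerBl addrA [X *m N + _]addrC e addrC addKr.
have e2 m : N ^+ m * X = X * (N + c%:M) ^+ m.
  elim: m => [|m IH]; first by rewrite !expr0 mul1r mulr1.
  by rewrite exprSr -mulrA e1 mulrA IH -mulrA -exprSr.
have N0 : N ^+ d'.+1 = 0.
  apply/matrixP => i j; rewrite nilN_exp mxE.
  by have := ltn_ord j; case: eqP => //=; lia.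
have U : N + c%:M \is a GRing.unit.
  rewrite -[_ \is a _]/(_ \in unitmx) unitmxE -det_tr det_trig.
    rewrite unitfE; apply/prodf_neq0 => i _.
    by rewrite !mxE eqxx (_ : (i == i.+1 :> nat) = false) ?add0r //; apply/eqP; lia.
  apply/is_trig_mxP => i j lt_ij; rewrite !mxE.
  rewrite -val_eqE /= (_ : (i == j.+1 :> nat) = false); last by apply/eqP; lia.
  by rewrite (_ : (j == i :> nat) = false) ?addr0 //; apply/eqP; lia.
have := e2 d'.+1; rewrite N0 mul0r => e3.
by rewrite -[X](mulrK (unitrX d'.+1 U)) -e3 mul0r.
Qed.
End Nilpotent.

Section Carlitz.
Variable Fq : finFieldType.
Local Notation q := #|Fq|.

Local Notation K := {fraction {poly Fq}}.

Definition theta : K := ('X : {poly Fq})%:F.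

Definition frobq (c : K) : K := c ^+ q.

Let pnat_q : [pchar K].-nat q.
Proof.
have [p p_pr pcharF] := finPcharP Fq.
have p_K : p \in [pchar K].
  by apply: (rmorph_pchar (@FracField.tofrac {poly Fq})); rewrite pchar_poly.
rewrite (eq_pnat _ (pcharf_eq p_K)).
by have := pprimeChar_pgroup pcharF; rewrite /pgroup cardsT.
Qed.

Let frobq_zmod : zmod_morphism frobq.
Proof.
move=> a b; rewrite /frobq.
have := exprDn_pchar (a - b) b pnat_q; rewrite subrK => ->.
by rewrite addrK.
Qed.

Let frobq_monoid : monoid_morphism frobq.
Proof. by split=> [|a b]; rewrite /frobq ?expr1n ?exprMn. Qed.

HB.instance Definition _ := GRing.isZmodMorphism.Build K K frobq frobq_zmod.
HB.instance Definition _ := GRing.isMonoidMorphism.Build K K frobq frobq_monoid.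

Definition twist1 (n : nat) : 'M[K]_n.+1 -> 'M[K]_n.+1 := map_mx frobq.
HB.instance Definition _ n := GRing.RMorphism.on (@twist1 n).

Variable d' : nat.
Local Notation M := 'M[K]_d'.+1.
Local Notation Mtau := (skewpoly (@twist1 d')).

Definition twist (k : nat) (A : M) : M := map_mx (fun c => c ^+ (q ^ k)) A.

Definition thetaN : M := theta%:M + nilN d' K.

Definition Ctheta : Mtau := skewC thetaN + skewC (delta_mx ord_max ord0) * tau.

Definition is_exp (Q : nat -> M) : Prop :=
  Q 0%N = 1 /\
  forall n, skew_mul (@twist1 d') Q (skewcoef (skewC thetaN : Mtau)) n
            = skew_mul (@twist1 d') (skewcoef Ctheta) Q n.

(* The exponent -d is taken in the matrix ring over K(x); the
   specialization x = theta is applied to the entries of the result. *)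
Definition Gamma (k : nat) : M :=
  map_mx (frac_eval (horner_eval theta))
    (bd d' (\prod_(1 <= i < k.+1) ('X - (theta ^+ (q ^ i))%:P))%:F ^- d'.+1).

Definition bE (Q : nat -> M) (k : nat) : Mtau :=
  skewC (Gamma k)^-1 *
    \sum_(j < k.+1) skewC (Q j * twist j (Gamma (k - j))) * tau ^+ j.

Local Notation K3 := {mpoly K[3]}.
(* The variables x, y, z. *)
Local Notation ix := (@Ordinal 3 0 isT).
Local Notation iy := (@Ordinal 3 1 isT).
Local Notation iz := (@Ordinal 3 2 isT).

Definition fd : K3 :=
  \sum_(j < d'.+1) ('X_iz - 'X_iy) ^+ j * ('X_ix - 'X_iy) ^+ (d' - j).

Definition calL (i : nat) : M :=
  let num : K3 := \prod_(1 <= m < i.+1) ('X_ix - (theta ^+ (q ^ m))%:MP) in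
  let den : K3 := \prod_(2 <= m < i.+2) ('X_iz - (theta ^+ (q ^ m))%:MP) in
  let point : 'I_3 -> K := tnth [tuple theta; theta ^+ (q ^ i.+1); theta ^+ q] in
  map_mx (frac_eval (meval point)) (bDelta d' ix iz (fd%:F * (num%:F / den%:F) ^+ d'.+1)).

End Carlitz.

Section ExpExistence.
Variables (Fq : finFieldType) (d' : nat).
Local Notation K := {fraction {poly Fq}}.
Local Notation q := #|Fq|.
Local Notation M := 'M[K]_d'.+1.
Local Notation N := (nilN d' K).

Lemma is_expE (Q : nat -> M) : is_exp Q <->
  Q 0%N = 1 /\ forall n, Q n.+1 * iter n.+1 (@twist1 Fq d') (thetaN Fq d')
    = thetaN Fq d' * Q n.+1 + delta_mx ord_max ord0 * twist1 (Q n).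
Proof.
have L n : skew_mul (@twist1 Fq d') Q
    (skewcoef (skewC (thetaN Fq d') : skewpoly (@twist1 Fq d'))) n
    = Q n * iter n (@twist1 Fq d') (thetaN Fq d').
  rewrite /skew_mul big_ord_recr /= subnn skewcoefC /= big1 ?add0r // => i _.
  rewrite skewcoefC subn_eq0 leqNgt ltn_ord /=.
  by have -> : iter i (@twist1 Fq d') 0 = 0; [elim: (nat_of_ord i) => //= k ->; rewrite rmorph0|rewrite mulr0].
have C i : skewcoef (Ctheta Fq d') i =
    if i is i'.+1 then (if i' is 0 then delta_mx ord_max ord0 else 0) else thetaN Fq d'.
  rewrite /Ctheta skewcoefD skewcoefC skewcoefM /skew_mul.
  rewrite big_ord_recl big1 ?addr0 => [|j _]; last by rewrite skewcoefC mul0r.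
  rewrite skewcoefC /= subn0 /tau /skewcoef coefX.
  by case: i => [|[|i]]; rewrite /= ?mulr0 ?addr0 ?add0r ?mulr1.
have C0 : skew_mul (@twist1 Fq d') (skewcoef (Ctheta Fq d')) Q 0 = thetaN Fq d' * Q 0%N.
  by rewrite /skew_mul big_ord1 C.
have CS n : skew_mul (@twist1 Fq d') (skewcoef (Ctheta Fq d')) Q n.+1 =
    thetaN Fq d' * Q n.+1 + delta_mx ord_max ord0 * twist1 (Q n).
  rewrite /skew_mul 2!big_ord_recl big1 ?addr0 => [|i _]; last by rewrite C mul0r.
  by rewrite !C /= subn0 subSS subn0.
split=> -[Q0 QE]; split=> // n; first by rewrite -CS -L.
by case: n => [|n]; rewrite L ?CS // C0 Q0 /= mulr1 mul1r.
Qed.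

Lemma twist_iter k (A : M) : twist k A = iter k (@twist1 Fq d') A.
Proof.
elim: k => [|k IH]; first by apply/matrixP => i j; rewrite mxE expn0 expr1.
by rewrite iterS -IH; apply/matrixP => i j; rewrite !mxE /frobq -exprM -expnSr.
Qed.

(* [is_exp] does characterize a unique series. *)
Lemma exp_exists_unique : exists Q : nat -> M,
  is_exp Q /\ forall Q', is_exp Q' -> Q' =1 Q.
Proof.
pose th n : K := theta Fq ^+ (q ^ n).
pose g n (X : M) : M := X * iter n (@twist1 Fq d') (thetaN Fq d') - thetaN Fq d' * X.
have gD n : linear (g n).
  move=> c X Y; rewrite /g mulrDl mulrDr scalerBr -scalerAl -scalerAr.
  by rewrite opprD addrACA.
have thN n : iter n (@twist1 Fq d') (thetaN Fq d') = (th n)%:M + N.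
  elim: n => [|n IH]; first by rewrite /thetaN /th expn0 expr1.
  rewrite iterS IH rmorphD /= /twist1 map_scalar_mx /= /frobq /th -exprM -expnSr.
  by congr (_ + _); apply/matrixP => i j; rewrite !mxE; case: eqP => _; [exact: (rmorph1 (@frobq Fq)) | exact: (rmorph0 (@frobq Fq))].
have gI n (X : M) : g n.+1 X = 0 -> X = 0.
  move/eqP; rewrite subr_eq0 thN /thetaN => /eqP.
  have e0N : th n.+1 - theta Fq != 0.
    rewrite subr_eq0 /th /theta -tofracXn tofrac_eq; apply/negP => /eqP.
    move/(congr1 (fun p : {poly Fq} => size p)); rewrite size_polyXn size_polyX => -[].
    by apply/eqP; rewrite gtn_eqF // -[X in (X < _)%N](exp1n n.+1) ltn_exp2r ?finNzRing_gt1.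
  exact: (nilN_sylvester e0N).
have gS n (Y : M) : exists X, g n.+1 X = Y.
  pose L := GRing.isLinear.Build K M M *:%R (g n.+1) (gD n.+1).
  pose gL : {linear M -> M} := HB.pack (g n.+1) L.
  have gE X : linfun gL X = g n.+1 X by rewrite lfunE.
  have k0 : lker (linfun gL) == 0%VS.
    apply/lker0P => X X'; rewrite !lfunE /= => eXX'; apply/eqP; rewrite -subr_eq0.
    by apply/eqP; apply: (gI n); rewrite -[g _ _]/(gL _) linearB /= eXX' subrr.
  by exists ((linfun gL)^-1%VF Y); rewrite -gE lker0_lfunVK.
pose step n (A : M) : M := epsilon (inhabits 0) (fun X =>
  g n.+1 X = delta_mx ord_max ord0 * twist1 A).
have stepP n A : g n.+1 (step n A) = delta_mx ord_max ord0 * twist1 A.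
  exact: (epsilon_spec (inhabits (0 : M)) _ (gS n _)).
pose Q := fix Q n : M := if n is m.+1 then step m (Q m) else 1.
have gE n (X A : M) : X * iter n.+1 (@twist1 Fq d') (thetaN Fq d')
    = thetaN Fq d' * X + delta_mx ord_max ord0 * twist1 A <->
    g n.+1 X = delta_mx ord_max ord0 * twist1 A.
  rewrite /g; split=> [->|<-]; first by rewrite addrC addKr.
  by rewrite addrC subrK.
exists Q; split; first by apply/is_expE; split=> // n; apply/gE; apply: stepP.
move=> Q' /is_expE[Q'0 Q'E]; elim=> [|n IH]; first by rewrite Q'0.
have /gE e := Q'E n; apply/eqP; rewrite -subr_eq0; apply/eqP; apply: (gI n).
have -> : Q' n.+1 - Q n.+1 = (-1) *: Q n.+1 + Q' n.+1 by rewrite scaleN1r addrC.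
by rewrite gD e IH -(stepP n (Q n)) scaleN1r addNr.
Qed.
End ExpExistence.

(* Main.v *)
(** Write [T_a = theta^(q^a) + N] and [D(a; m, n) = (prod_(m <= i < n) (T_a - theta^(q^i)))^d].
Since [f |-> d_x f] is multiplicative and sends [x] to [T_0] at [x = theta], [Gamma_k]
is the inverse of [D(0; 1, k+1)], and its [j]-th twist the inverse of [D(j; j+1, j+k+1)].
Likewise [Delta_(x,z) (a(x) b(z)) = d_x(a) e_(d,1) d_z(b)], so that
[L_k = D(0; 1, k+1) S D(1; 2, k+2)^-1] with
[S = sum_m (T_0 - y)^(d-1-m) e_(d,1) (T_1 - y)^m] and [y = theta^(q^(k+1))].
Iterating [Q_(j+1) (T_(j+1) - y) = (T_0 - y) Q_(j+1) + e_(d,1) Q_j^(1)] gives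
[Q_(j+1) (T_(j+1) - y)^d = (T_0 - y)^d Q_(j+1) + S Q_j^(1)], where the terms
involving [Q_(j-1)] vanish because [e_(d,1) (T_1 - y)^r e_(d,1) = 0] for [r < d - 1].
This is [E_(k+1) = (1 - L_k tau) E_k], coefficient by coefficient; for [j = k] the
left-hand side is zero, as [T_(k+1) - y = N]. *)
Require Import Defs.
From mathcomp Require Import all_boot all_order all_algebra finfield zify.
From mathcomp.multinomials Require Import mpoly.

Set Implicit Arguments.
Unset Strict Implicit.
Unset Printing Implicit Defensive.

Import GRing.Theory.
Local Open Scope ring_scope.

(** * Specialization of matrices of fractions *)

Lemma frac_eval_mx (R : idomainType) (L : fieldType) (phi : {rmorphism R -> L})
    (n : nat) (A B : 'M[R]_n.+1) :
  map_mx phi B \is a GRing.unit ->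
  map_mx (frac_eval phi)
    (map_mx (@FracField.tofrac R) A * (map_mx (@FracField.tofrac R) B)^-1)
  = map_mx phi A * (map_mx phi B)^-1.
Proof.
move=> uB; have uB' : map_mx phi B \in unitmx by [].
have dB : phi (\det B) != 0.
  by move: uB'; rewrite unitmxE unitfE det_map_mx.
have dB' : (\det B)%:F != 0.
  by rewrite tofrac_eq0; apply: contraNneq dB => ->; rewrite rmorph0.
have uFB : map_mx (@FracField.tofrac R) B \in unitmx.
  by rewrite unitmxE unitfE det_map_mx.
(* By Cramer's rule all entries have the common denominator [\det B], which [phi] does not kill, so
   [frac_evalE] applies to that writing. *)
rewrite -[_^-1 in LHS]/(invmx _) -[_^-1 in RHS]/(invmx _) /invmx uFB uB'.
rewrite -!scalerAr -!map_mx_adj -!mulmxE -!map_mxM !det_map_mx.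
by apply/matrixP => i j; rewrite !mxE mulrC frac_evalE // mulrC.
Qed.

(** * Higher derivations, their constants and their Toeplitz matrices *)

Record higher_derivation (R : nzRingType) (D : nat -> R -> R) : Prop := {
  hder_id : D 0%N =1 id;
  hderB : forall j u v, D j (u - v) = D j u - D j v;
  hderM : forall j u v, D j (u * v) = \sum_(i < j.+1) D (j - i)%N u * D i v;
  hder1 : forall j, D j.+1 1 = 0 }.

(** Stated as linearity of every [D j] over [c], which makes closure under products immediate;
    [hder_const0] and [hder_constP] relate it to the vanishing of the derivatives of [c] of positive
    order. *)
Definition hder_const (R : nzRingType) (D : nat -> R -> R) (c : R) : Prop :=
  forall j u, D j (c * u) = c * D j u.

Section HasseMatrix.
Variables (R : nzRingType) (D : nat -> R -> R) (hD : higher_derivation D).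

Lemma hder_const0 c j : hder_const D c -> D j.+1 c = 0.
Proof. by move=> hc; rewrite -[c]mulr1 hc (hder1 hD) mulr0. Qed.

Lemma hder0 j : D j 0 = 0.
Proof. by rewrite -{1}(subrr 0) (hderB hD) subrr. Qed.

Lemma hderD j u v : D j (u + v) = D j u + D j v.
Proof. by rewrite -{1}[v]opprK (hderB hD) -[- v]sub0r (hderB hD) hder0 sub0r opprK. Qed.

Lemma hder_sum j (I : Type) (r : seq I) (P : pred I) (F : I -> R) :
  D j (\sum_(i <- r | P i) F i) = \sum_(i <- r | P i) D j (F i).
Proof. exact: (big_morph (D j) (hderD j) (hder0 j)). Qed.

Lemma hder_constP c : (forall j, D j.+1 c = 0) -> hder_const D c.
Proof.
move=> c0 j u; rewrite (hderM hD) big_ord_recr /= subnn (hder_id hD) big1 ?add0r //.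
by move=> i _; rewrite -(subnSK (ltn_ord i)) c0 mul0r.
Qed.

Lemma hder_constM c c' : hder_const D c -> hder_const D c' -> hder_const D (c * c').
Proof. by move=> hc hc' j u; rewrite -mulrA hc hc' mulrA. Qed.

Lemma hder_constB c c' : hder_const D c -> hder_const D c' -> hder_const D (c - c').
Proof. by move=> hc hc' j u; rewrite mulrBl (hderB hD) hc hc' mulrBl. Qed.

Lemma hder_const1 : hder_const D 1.
Proof. by move=> j u; rewrite !mul1r. Qed.

Lemma hder_const_prod (I : Type) (r : seq I) (P : pred I) (F : I -> R) :
  (forall i, hder_const D (F i)) -> hder_const D (\prod_(i <- r | P i) F i).
Proof.
by move=> hF; apply: big_ind => //; [exact: hder_const1 | exact: hder_constM].
Qed.

Lemma hder_constX c n : hder_const D c -> hder_const D (c ^+ n).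
Proof.
move=> hc; elim: n => [|n IH]; first by rewrite expr0; apply: hder_const1.
by rewrite exprS; apply: hder_constM.
Qed.

Variables (L : nzRingType) (phi : {rmorphism R -> L}) (d' : nat).

(* The matrix [sum_j phi (D_j u) N^j], cf. [bd_tofrac]. *)
Definition hasse_mx (u : R) : 'M[L]_d'.+1 :=
  \matrix_(i, j) if (i <= j)%N then phi (D (j - i)%N u) else 0.

Lemma hasse_mxB u v : hasse_mx (u - v) = hasse_mx u - hasse_mx v.
Proof.
apply/matrixP => i j; rewrite !mxE; case: leqP => _; last by rewrite subrr.
by rewrite (hderB hD) rmorphB.
Qed.

Lemma hasse_mx_const c : hder_const D c -> hasse_mx c = (phi c)%:M.
Proof.
move=> hc; apply/matrixP => i j; rewrite !mxE -val_eqE /=.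
case: ltngtP => [lt_ij||->]; last by rewrite subnn (hder_id hD) mulr1n.
  by rewrite -(subnSK lt_ij) hder_const0 // rmorph0.
by [].
Qed.

Lemma hasse_mx1 : hasse_mx 1 = 1.
Proof. by rewrite (hasse_mx_const hder_const1) rmorph1. Qed.

(** The product rule is multiplication of upper triangular Toeplitz matrices. This is the source of
    the multiplicativity of [d_x]. *)
Lemma hasse_mxM u v : hasse_mx (u * v) = hasse_mx u * hasse_mx v.
Proof.
apply/matrixP => i j; rewrite !mxE.
have E (l : 'I_d'.+1) : hasse_mx u i l * hasse_mx v l j =
    if (i <= l <= j)%N then phi (D (l - i)%N u * D (j - l)%N v) else 0.
  rewrite !mxE; case: leqP => _ /=; last by rewrite mul0r.
  by case: leqP => _; rewrite ?mulr0 // rmorphM.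
under eq_bigr do rewrite E.
rewrite -big_mkcond /=.
case: leqP => [le_ij|lt_ji]; last first.
  by rewrite big1 // => l /andP[h1 h2]; have := leq_trans h1 h2; rewrite leqNgt lt_ji.
rewrite -rmorph_sum /=; congr (phi _).
rewrite (hderM hD).
(* Reversal makes the order falling on [u] the summation index; a shift by [i] then turns it into
   [l - i]. *)
rewrite (reindex_inj rev_ord_inj) /=.
transitivity (\sum_(0 <= l < (j - i).+1) D l u * D (j - i - l)%N v).
  rewrite big_mkord; apply: eq_bigr => l _; rewrite subSS.
  by rewrite subKn // -ltnS.
transitivity (\sum_(0 <= l < d'.+1 | (i <= l <= j)%N) D (l - i)%N u * D (j - l)%N v);
  last by rewrite big_mkord.
have lt_j := ltn_ord j.
rewrite [RHS](big_cat_nat (n := i)) //=; last by lia.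
rewrite [X in _ = X + _]big_nat_cond [X in _ = X + _]big_pred0 ?add0r; last first.
  by move=> l; apply/negbTE; lia.
rewrite [RHS](big_cat_nat (n := j.+1)) //=; last by lia.
rewrite [X in _ = _ + X]big_nat_cond [X in _ = _ + X]big_pred0 ?addr0; last first.
  by move=> l; apply/negbTE; lia.
rewrite -[in RHS](add0n i) big_addn subSn // add0n.
rewrite [RHS]big_nat_cond [LHS]big_nat_cond.
apply: eq_big => [l|l /andP[/andP[_ lt_l] _]]; first by lia.
by rewrite addnK; congr (_ * D _ v); lia.
Qed.

Lemma hasse_mx_prod (I : Type) (r : seq I) (P : pred I) (F : I -> R) :
  hasse_mx (\prod_(i <- r | P i) F i) = \prod_(i <- r | P i) hasse_mx (F i).
Proof. exact: (big_morph _ hasse_mxM hasse_mx1). Qed.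

Lemma hasse_mxX u n : hasse_mx (u ^+ n) = hasse_mx u ^+ n.
Proof.
elim: n => [|n IH]; first by rewrite !expr0 hasse_mx1.
by rewrite !exprS hasse_mxM IH.
Qed.

End HasseMatrix.

Lemma map_hasse_mx (R L : nzRingType) (D : nat -> R -> R) (phi : {rmorphism R -> L})
    (d' : nat) (u : R) :
  map_mx phi (hasse_mx D idfun d' u) = hasse_mx D phi d' u.
Proof. by apply/matrixP => i j; rewrite !mxE; case: ifP; rewrite ?rmorph0. Qed.

(** * Extension of a higher derivation to fractions *)

Section FracHasse.
Variables (R : idomainType) (D : nat -> R -> R) (hD : higher_derivation D).

(** The quotient rule is a triangular system with nonzero diagonal coefficient [v], so it determines
    the derivatives. The identities for [frac_hasse] below are proved by checking this system. *)
Lemma frac_hasse_unique u v (c : nat -> {fraction R}) : v != 0 ->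
  (forall j, \sum_(i < j.+1) (D (j - i)%N v)%:F * c i = (D j u)%:F) ->
  forall j, frac_hasse D j (u%:F / v%:F) = c j.
Proof.
move=> v0 hc j; elim/ltn_ind: j => j IH.
have := frac_hasse_quotient (hder_id hD) (hderM hD) u v0 j.
rewrite -hc !big_ord_recr /= subnn (hder_id hD).
under eq_bigr do rewrite IH //.
by move/addrI/mulfI; apply; rewrite tofrac_eq0.
Qed.

Lemma frac_writing (f : {fraction R}) : exists u v, v != 0 /\ f = u%:F / v%:F.
Proof.
exists (\n_(repr f)), (\d_(repr f)); split; first exact: denom_ratioP.
by rewrite -frac_numden mulfK // tofrac_eq0 denom_ratioP.
Qed.

Lemma frac_hasse_tofrac j u : frac_hasse D j u%:F = (D j u)%:F.
Proof.
have := @frac_hasse_unique u 1 (fun j => (D j u)%:F) (oner_neq0 _).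
rewrite tofrac1 divr1; apply=> {}j; rewrite big_ord_recr /= subnn (hder_id hD).
rewrite tofrac1 mul1r big1 ?add0r // => i _.
by rewrite -(subnSK (ltn_ord i)) (hder1 hD) tofrac0 mul0r.
Qed.

Lemma frac_hasseD j f g :
  frac_hasse D j (f + g) = frac_hasse D j f + frac_hasse D j g.
Proof.
have [u [v [v0 ->]]] := frac_writing f; have [u' [v' [v'0 ->]]] := frac_writing g.
have hq := frac_hasse_quotient (hder_id hD) (hderM hD).
(* Over a common denominator both fractions satisfy the same linear system, and the right-hand sides
   add up. *)
have -> : u%:F / v%:F = (u * v')%:F / (v * v')%:F.
  by rewrite !tofracM -mulf_div divff ?mulr1 // tofrac_eq0.
have -> : u'%:F / v'%:F = (u' * v)%:F / (v * v')%:F.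
  by rewrite [v * _]mulrC !tofracM -mulf_div divff ?mulr1 // tofrac_eq0.
have vv0 : v * v' != 0 by rewrite mulf_neq0.
rewrite -mulrDl -tofracD; apply: (@frac_hasse_unique _ _
  (fun j => frac_hasse D j ((u * v')%:F / (v * v')%:F)
            + frac_hasse D j ((u' * v)%:F / (v * v')%:F))) => // {}j.
rewrite (hderD hD) tofracD -(hq _ _ vv0) -(hq _ _ vv0) -big_split /=.
by apply: eq_bigr => i _; rewrite mulrDr.
Qed.

Lemma frac_hasse_sum j (I : Type) (r : seq I) (P : pred I) (F : I -> {fraction R}) :
  frac_hasse D j (\sum_(i <- r | P i) F i) = \sum_(i <- r | P i) frac_hasse D j (F i).
Proof.
apply: (big_morph (frac_hasse D j) (frac_hasseD j)).
by rewrite -tofrac0 frac_hasse_tofrac (hder0 hD).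
Qed.

Lemma frac_hasse_const j c f : hder_const D c ->
  frac_hasse D j (c%:F * f) = c%:F * frac_hasse D j f.
Proof.
move=> hc; have [u [v [v0 ->]]] := frac_writing f.
rewrite mulrA -tofracM; apply: (@frac_hasse_unique _ _
  (fun j => c%:F * frac_hasse D j (u%:F / v%:F))) => // {}j.
rewrite hc tofracM -(frac_hasse_quotient (hder_id hD) (hderM hD) _ v0) mulr_sumr.
by apply: eq_bigr => i _; rewrite mulrCA.
Qed.

End FracHasse.

(** * Hasse derivatives of polynomials in one and several variables *)

Lemma nderivn_hder (R : comNzRingType) :
  higher_derivation (fun j (p : {poly R}) => p^`N(j)).
Proof.
split=> [p|j u v|j u v|j]; first exact: nderivn0.
- exact: linearB.
- exact: nderivnM.
- by rewrite -[1]/(1%:P) nderivnC.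
Qed.

Section MultiHasse.
Variables (R : comNzRingType) (n : nat).

Lemma mhasse_hder (i : 'I_n) : higher_derivation (@mhasse R n i).
Proof.
split=> [p|j u v|j u v|j]; first exact: mhasse0.
- exact: linearB.
- exact: mhasseM.
- by rewrite -mpolyX0 mhasseX mnm0E bin0n.
Qed.

(** On a monomial the two derivatives act on separate exponents. *)
Lemma mhasse_comm (x z : 'I_n) j l (p : {mpoly R[n]}) : x != z ->
  mhasse x j (mhasse z l p) = mhasse z l (mhasse x j p).
Proof.
move=> xz; elim/mpolyind: p => [|c m p _ _ IH]; first by rewrite !linear0.
rewrite !(linearD, linearZ) /= IH; congr (_ *: _ + _).
rewrite !mhasseX !linearMn /= !mhasseX !mnmBE !mulmnE !mnm1E.
rewrite [z == x]eq_sym (negbTE xz) !mul0n !subn0 mulrnAC; congr (_ *+ _ *+ _).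
by congr 'X_[_]; apply/mnmP => s; rewrite !mnmBE subnAC.
Qed.

Lemma mhasse_const_hasse (x z : 'I_n) l c : x != z ->
  hder_const (@mhasse R n x) c -> hder_const (@mhasse R n x) (mhasse z l c).
Proof.
move=> xz hc; have hx := mhasse_hder x; apply: hder_constP => // j.
by rewrite mhasse_comm // (hder_const0 hx) // linear0.
Qed.

Lemma mhasse_constX (x i : 'I_n) : x != i -> hder_const (@mhasse R n x) 'X_i.
Proof.
move=> xi; apply: (hder_constP (mhasse_hder x)) => j.
by rewrite mhasseX mnm1E eq_sym (negbTE xi) bin0n.
Qed.

Lemma mhasse_constC (x : 'I_n) c : hder_const (@mhasse R n x) c%:MP.
Proof. by move=> j u; rewrite !mul_mpolyC linearZ. Qed.

End MultiHasse.

(** * Specialization of [bd] and [bDelta] *)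

Lemma unit_map_tofrac (R : idomainType) (L : fieldType) (phi : {rmorphism R -> L})
    (n : nat) (B : 'M[R]_n.+1) :
  map_mx phi B \is a GRing.unit -> map_mx (@FracField.tofrac R) B \is a GRing.unit.
Proof.
move=> uB; have {uB} : map_mx phi B \in unitmx by [].
suff : map_mx phi B \in unitmx -> map_mx (@FracField.tofrac R) B \in unitmx by [].
rewrite !unitmxE !unitfE !det_map_mx tofrac_eq0.
by apply: contraNneq => ->; rewrite rmorph0.
Qed.

Lemma hasse_mx_var (R L : nzRingType) (D : nat -> R -> R) (phi : {rmorphism R -> L})
    (d' : nat) (u : R) : higher_derivation D ->
  D 1%N u = 1 -> (forall j, D j.+2 u = 0) ->
  hasse_mx D phi d' u = (phi u)%:M + nilN d' L.
Proof.
move=> hD D1 D2; apply/matrixP => i j; rewrite !mxE -val_eqE /=.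
case: ltngtP => [lt_ij|lt_ji|->].
- rewrite mulr0n add0r -(subnSK lt_ij).
  move: (subnK lt_ij); case: (j - i.+1)%N => [|m] <-; first by rewrite D1 rmorph1 add0n eqxx.
  by rewrite D2 rmorph0 gtn_eqF // addSn ltnS leq_addl.
- by rewrite mulr0n add0r ltn_eqF // ltnS ltnW.
- by rewrite subnn (hder_id hD) mulr1n ltn_eqF ?addr0.
Qed.

Lemma mul_delta_mxE (R : nzRingType) (n : nat) (A B : 'M[R]_n.+1) (k l i j : 'I_n.+1) :
  (A * delta_mx k l * B) i j = A i k * B l j.
Proof.
rewrite mxE (bigD1 l) //= mxE (bigD1 k) //= mxE !eqxx mulr1.
rewrite big1 ?addr0 => [|s /negbTE sk]; last by rewrite mxE sk mulr0.
rewrite big1 ?addr0 // => s /negbTE sl.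
by rewrite mxE big1 ?mul0r // => r _; rewrite mxE sl andbF mulr0.
Qed.

(** The power [N ^+ l] lives on the [l]-th superdiagonal only, so the entry [(i, j)] picks out the
    derivative of order [j - i]. *)
Lemma bd_tofrac (F : fieldType) (d' : nat) (p : {poly F}) :
  bd d' p%:F = map_mx (@FracField.tofrac {poly F})
                 (hasse_mx (fun j (u : {poly F}) => u^`N(j)) idfun d' p).
Proof.
apply/matrixP => i j; rewrite !mxE summxE.
under eq_bigr => l _.
  rewrite mxE nilN_exp (frac_hasse_tofrac (nderivn_hder F)); over.
case: leqP => [le_ij|lt_ji]; last first.
  rewrite tofrac0 big1 // => l _; rewrite ltn_eqF ?mulr0 //.
  exact: leq_trans lt_ji (leq_addr _ _).
have lt_d : (j - i < d'.+1)%N by apply: leq_ltn_trans (leq_subr _ _) _.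
rewrite (bigD1 (Ordinal lt_d)) //= subnKC // eqxx mulr1 big1 ?addr0 //.
move=> l; rewrite -val_eqE /= => nl; case: eqP => e; last by rewrite mulr0.
by rewrite e addKn eqxx in nl.
Qed.

(** In each row, right multiplication by the Toeplitz matrix of [v] produces the quotient rule in
    [z]. Since [v] and its [z]-derivatives are constant in [x], the [x]-derivatives pass through
    them, and the denominators of [bDelta] are cleared. *)
Lemma bDelta_quotient (F : fieldType) (d' n : nat) (x z : 'I_n)
    (u v : {mpoly F[n]}) : x != z -> v != 0 -> hder_const (mhasse x) v ->
  bDelta d' x z (u%:F / v%:F)
    * map_mx (@FracField.tofrac {mpoly F[n]}) (hasse_mx (mhasse z) idfun d' v)
  = map_mx (@FracField.tofrac {mpoly F[n]})
      (\matrix_(i, j) mhasse x (d' - i) (mhasse z j u)).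
Proof.
move=> xz v0 cv; apply/matrixP => i j; rewrite !mxE.
have hx := mhasse_hder F x; have hz := mhasse_hder F z.
rewrite -(frac_hasse_tofrac hx) -(frac_hasse_quotient (hder_id hz) (hderM hz) u v0).
rewrite (frac_hasse_sum hx).
rewrite (big_ord_widen d'.+1 (fun l => frac_hasse (mhasse x) (d' - i)
  ((mhasse z (j - l) v)%:F * frac_hasse (mhasse z) l (u%:F / v%:F)))) //.
rewrite [RHS]big_mkcond; apply: eq_bigr => l _; rewrite !mxE ltnS.
case: leqP => _; last by rewrite tofrac0 mulr0.
have cx := mhasse_const_hasse (j - l) xz cv.
by rewrite (frac_hasse_const hx _ _ cx) [LHS]mulrC.
Qed.

Lemma frac_eval_bDelta (F L : fieldType) (d' n : nat)
    (phi : {rmorphism {mpoly F[n]} -> L}) (x z : 'I_n) (u v : {mpoly F[n]}) :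
  x != z -> hder_const (mhasse x) v ->
  hasse_mx (mhasse z) phi d' v \is a GRing.unit ->
  map_mx (frac_eval phi) (bDelta d' x z (u%:F / v%:F))
  = \matrix_(i, j) phi (mhasse x (d' - i) (mhasse z j u))
      * (hasse_mx (mhasse z) phi d' v)^-1.
Proof.
move=> xz cv uv; have hz := mhasse_hder F z.
have v0 : v != 0.
  apply/eqP => v0; move: uv.
  by rewrite v0 -(subrr 0) (hasse_mxB hz) subrr unitr0.
rewrite -map_hasse_mx in uv *.
have /(canRL (mulrK (unit_map_tofrac uv))) -> := bDelta_quotient d' u xz v0 cv.
by rewrite frac_eval_mx //; congr (_ * _); apply/matrixP => i j; rewrite !mxE.
Qed.

(** The mixed derivative of [a * b] factors into an [x]-derivative of [a] of order [d' - i], found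
    in the last column of the matrix of [a], and a [z]-derivative of [b] of order [j], found in the
    first row of the matrix of [b]. *)
Lemma mhasse_mx_split (F L : fieldType) (phi : {rmorphism {mpoly F[3]} -> L}) (d' : nat)
    (x z : 'I_3) (a b : {mpoly F[3]}) :
  hder_const (mhasse z) a -> hder_const (mhasse x) b -> x != z ->
  \matrix_(i < d'.+1, j < d'.+1) phi (mhasse x (d' - i) (mhasse z j (a * b)))
  = hasse_mx (mhasse x) phi d' a * delta_mx ord_max ord0 * hasse_mx (mhasse z) phi d' b.
Proof.
move=> ha hb xz; apply/matrixP => i j; rewrite mul_delta_mxE !mxE /= subn0.
rewrite -ltnS ltn_ord ha mulrC (mhasse_const_hasse _ xz hb) rmorphM /=.
by rewrite mulrC.
Qed.

Lemma hasse_mx_mhasseX (R L : comNzRingType) (n : nat) (phi : {rmorphism {mpoly R[n]} -> L})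
    (d' : nat) (i : 'I_n) :
  hasse_mx (mhasse i) phi d' 'X_i = (phi 'X_i)%:M + nilN d' L.
Proof.
apply: hasse_mx_var => [||j]; first exact: mhasse_hder.
  rewrite mhasseX mnm1E eqxx bin1 mulr1n -mpolyX0; congr 'X_[_].
  by apply/mnmP => s; rewrite mnmBE mulmnE muln1 subnn mnm0E.
by rewrite mhasseX mnm1E eqxx.
Qed.

(** * Closed forms of [Gamma] and [calL] *)

Section CarlitzTwists.
Variables (Fq : finFieldType) (d' : nat).
Local Notation q := #|Fq|.
Local Notation K := {fraction {poly Fq}}.
Local Notation K3 := {mpoly K[3]}.
Local Notation M := 'M[K]_d'.+1.
Local Notation N := (nilN d' K).
Local Notation e := (delta_mx ord_max ord0 : M).
Local Notation t i := (theta Fq ^+ (q ^ i)).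

(* [T_a - theta^(q^s)], where [T_a] is the [a]-fold twist of [theta + N]. *)
Definition shiftN (a s : nat) : M := (t a)%:M + N - (t s)%:M.
Definition shift_prod (a m n : nat) : M := (\prod_(m <= s < n) shiftN a s) ^+ d'.+1.
(** This is [Delta_(x,z) (f_d)] at the point where [calL k] is evaluated, each summand of [f_d]
    being split by [mhasse_mx_split]. *)
Definition shift_sum (k : nat) : M :=
  \sum_(m < d'.+1) shiftN 0 k.+1 ^+ (d' - m) * e * shiftN 1 k.+1 ^+ m.

Lemma theta_pow_neq a s : (a < s)%N -> t a - t s != 0.
Proof.
move=> lt_as; rewrite subr_eq0 /theta -!tofracXn tofrac_eq; apply/negP => /eqP.
move/(congr1 (fun p : {poly Fq} => size p)); rewrite !size_polyXn => -[] /eqP.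
by rewrite (eqn_exp2l _ _ (finNzRing_gt1 Fq)) ltn_eqF.
Qed.

Lemma shiftNE a s : shiftN a s = (t a - t s)%:M + N.
Proof. by rewrite /shiftN raddfB addrAC. Qed.

Lemma shiftN_unit a s : (a < s)%N -> shiftN a s \is a GRing.unit.
Proof.
move=> lt_as; rewrite shiftNE; suff : (t a - t s)%:M + N \in unitmx by [].
(* The matrix is upper triangular with [t a - t s] on the diagonal; it is transposed because
   [det_trig] is about lower triangular matrices. *)
rewrite unitmxE -det_tr det_trig.
  rewrite unitfE; apply/prodf_neq0 => i _.
  by rewrite !mxE eqxx ltn_eqF // addr0 theta_pow_neq.
apply/is_trig_mxP => i j lt_ij; rewrite !mxE -val_eqE /=.
by rewrite gtn_eqF // ltn_eqF ?addr0 // ltnS ltnW.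
Qed.

Lemma shift_prod_unit a m n : (a < m)%N -> shift_prod a m n \is a GRing.unit.
Proof.
move=> lt_am; apply: unitrX; rewrite big_nat_cond; apply: unitr_prod => s.
by move=> /andP[/andP[le_ms _] _]; apply: shiftN_unit; apply: leq_trans le_ms.
Qed.

Lemma GammaE k : Gamma Fq d' k = (shift_prod 0 1 k.+1)^-1.
Proof.
pose phi : {rmorphism {poly K} -> K} := horner_eval (theta Fq).
pose D j (u : {poly K}) := u^`N(j).
have hD : higher_derivation D by apply: nderivn_hder.
set p := \prod_(1 <= i < k.+1) ('X - (t i)%:P).
have hp : hasse_mx D phi d' p ^+ d'.+1 = shift_prod 0 1 k.+1.
  rewrite (hasse_mx_prod hD); congr (_ ^+ _); apply: eq_bigr => s _.
  rewrite (hasse_mxB hD); congr (_ - _).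
    rewrite hasse_mx_var //.
    - by rewrite /phi /= /horner_eval hornerX expn0 expr1.
    - by rewrite /D -['X]expr1 nderivnXn.
    - by move=> j; rewrite /D -['X]expr1 nderivnXn.
  rewrite (hasse_mx_const hD) /phi /= /horner_eval ?hornerC //.
  by move=> j u; rewrite /D !mul_polyC linearZ.
rewrite -hp -(map_hasse_mx D phi) -rmorphXn /=.
(* The inverse is put in the form [A * B^-1] with [A = 1], as [frac_eval_mx] requires. *)
rewrite -[X in _ = X]mul1r -[X in _ = X * _](rmorph1 (map_mx phi)).
rewrite -frac_eval_mx ?rmorph1 ?mul1r; last first.
  by rewrite rmorphXn /= map_hasse_mx hp shift_prod_unit.
by rewrite /Gamma bd_tofrac rmorphXn.
Qed.

Lemma calLE k :
  calL Fq d' k = shift_prod 0 1 k.+1 * shift_sum k * (shift_prod 1 2 k.+2)^-1.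
Proof.
rewrite /calL.
set ix := @Ordinal 3 0 isT; set iy := @Ordinal 3 1 isT; set iz := @Ordinal 3 2 isT.
set num := \prod_(1 <= m < k.+1) _; set den := \prod_(2 <= m < k.+2) _.
set point := tnth _.
pose phi : {rmorphism K3 -> K} := meval point.
have hx := mhasse_hder K ix; have hz := mhasse_hder K iz.
have xz : ix != iz by [].
have cC i c : hder_const (@mhasse K 3 i) c%:MP by apply: mhasse_constC.
have cX (i j : 'I_3) : i != j -> hder_const (@mhasse K 3 i) 'X_j.
  exact: mhasse_constX.
have hX (i : 'I_3) (a s : nat) : phi 'X_i = t a ->
    hasse_mx (mhasse i) phi d' ('X_i - (t s)%:MP) = shiftN a s.
  move=> phiX; have hi := mhasse_hder K i.
  rewrite (hasse_mxB hi) (hasse_mx_const hi phi d' (cC i (t s))) hasse_mx_mhasseX.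
  by rewrite phiX /phi /= mevalC.
have phix : phi 'X_ix = t 0 by rewrite /phi /= mevalXU expn0 expr1.
have phiy : phi 'X_iy = t k.+1 by rewrite /phi /= mevalXU.
have phiz : phi 'X_iz = t 1 by rewrite /phi /= mevalXU expn1.
(* The variable [y] is a constant for both derivations and specializes to [t k.+1]. *)
have hY (i : 'I_3) (a : nat) : i != iy -> phi 'X_i = t a ->
    hasse_mx (mhasse i) phi d' ('X_i - 'X_iy) = shiftN a k.+1.
  move=> iy' phiX; have hi := mhasse_hder K i.
  rewrite /shiftN -phiX -phiy -(hasse_mx_const hi phi d' (cX _ _ iy')) (hasse_mxB hi).
  by rewrite hasse_mx_mhasseX.
have hnum : hasse_mx (mhasse ix) phi d' (num ^+ d'.+1) = shift_prod 0 1 k.+1.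
  rewrite (hasse_mxX hx) (hasse_mx_prod hx); congr (_ ^+ _).
  by apply: eq_bigr => s _; apply: hX.
have hden : hasse_mx (mhasse iz) phi d' (den ^+ d'.+1) = shift_prod 1 2 k.+2.
  rewrite (hasse_mxX hz) (hasse_mx_prod hz); congr (_ ^+ _).
  by apply: eq_bigr => s _; apply: hX.
have cden : hder_const (@mhasse K 3 ix) (den ^+ d'.+1).
  apply: hder_constX; apply: hder_const_prod => s.
  by apply: (hder_constB hx); [apply: cX | apply: cC].
have cnum : hder_const (@mhasse K 3 iz) (num ^+ d'.+1).
  apply: hder_constX; apply: hder_const_prod => s.
  by apply: (hder_constB hz); [apply: cX | apply: cC].
have uden : hasse_mx (mhasse iz) phi d' (den ^+ d'.+1) \is a GRing.unit.
  by rewrite hden shift_prod_unit.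
rewrite expr_div_n -!tofracXn mulrA -tofracM.
rewrite (frac_eval_bDelta (fd Fq d' * num ^+ d'.+1) xz cden uden) hden; congr (_ * _).
rewrite /shift_sum mulr_sumr.
have cXY (i j : 'I_3) n : i != j -> i != iy ->
    hder_const (@mhasse K 3 i) (('X_j - 'X_iy) ^+ n).
  move=> ij iy'; apply: hder_constX; apply: (hder_constB (mhasse_hder K i)).
    exact: cX.
  exact: cX.
apply/matrixP => i j; rewrite mxE summxE /fd mulr_suml (hder_sum hz) (hder_sum hx).
rewrite rmorph_sum /=; apply: eq_bigr => m _; rewrite !mulrA.
rewrite -hnum -(hY ix 0%N) // -(hY iz 1%N) // -!hasse_mxX // -hasse_mxM //.
(* In each summand, [num ^+ d'.+1] times a power of [x - y] is constant in [z], and the power of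
   [z - y] is constant in [x]. *)
rewrite -mhasse_mx_split //; first last.
- exact: cXY.
- by apply: hder_constM => //; apply: cXY.
rewrite mxE; congr (phi (mhasse _ _ (mhasse _ _ _))).
by rewrite mulrC mulrA mulrAC.
Qed.

End CarlitzTwists.

(** * Intertwining relations and powers of [c + N] *)

Lemma intertwine_exp (R : nzRingType) (X U V Y E : R) (n : nat) :
  X * U = V * X + E * Y ->
  X * U ^+ n = V ^+ n * X + \sum_(m < n) V ^+ (n - m.+1) * (E * (Y * U ^+ m)).
Proof.
move=> XU; elim: n => [|n IH]; first by rewrite !expr0 mulr1 mul1r big_ord0 addr0.
(* The factors [U] cross [X] one at a time; each crossing turns [U] into [V] and leaves one term
   containing [E * Y]. *)
rewrite !exprS mulrA XU mulrDl -!mulrA IH mulrDr -addrA; congr (_ + _).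
rewrite big_ord_recr /= subnn expr0 mul1r mulr_sumr; congr (_ + _).
by apply: eq_bigr => m _; rewrite mulrA -exprS subSS subnSK.
Qed.

Lemma intertwine_scalar (R : comNzRingType) (n : nat) (X A B Y : 'M[R]_n.+1) (c : R) :
  X * A = B * X + Y -> X * (A + c%:M) = (B + c%:M) * X + Y.
Proof.
move=> XA; rewrite mulrDr mulrDl XA addrAC; congr (_ + _ + _).
exact: scalar_mxC.
Qed.

Lemma mulr_div_factor (R : unitRingType) (P X W W' U : R) :
  W' \is a GRing.unit -> U \is a GRing.unit -> W = W' * U ->
  P * X * W'^-1 = P * (X * U) * W^-1.
Proof. by move=> uW' uU ->; rewrite invrM // !mulrA mulrK. Qed.

(** The algebra behind [bE_coef_rec]: [P * S * D^-1] is [L_k], and [D * X' * W^-1] is a twisted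
    coefficient of [E_k], so that [D] cancels. *)
Lemma coef_rec_identity (R : unitRingType) (P X X' S D U V W : R) :
  D \is a GRing.unit -> X * U = V * X + S * X' ->
  P * V * X * W^-1 = P * (X * U) * W^-1 - P * S * D^-1 * (D * X' * W^-1).
Proof.
move=> uD ->; rewrite -!mulrA (mulKr uD) -mulrBr; congr (_ * _).
by rewrite mulrDl -!mulrA addrK.
Qed.

Lemma nilN_nilpotent (F : fieldType) (d' : nat) : nilN d' F ^+ d'.+1 = 0.
Proof.
apply/matrixP => i j; rewrite nilN_exp mxE ltn_eqF //.
by apply: leq_trans (ltn_ord j) (leq_addl _ _).
Qed.

Lemma nilN_shift_comm (F : fieldType) (d' : nat) (b c : F) :
  GRing.comm (b%:M + nilN d' F) (c%:M + nilN d' F).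
Proof.
have cs a (A : 'M[F]_d'.+1) : GRing.comm A a%:M.
  exact: scalar_mxC.
by apply: commrD => //; apply: commr_sym; apply: commrD.
Qed.

(** Each factor [c + N] widens the band above the diagonal by one. *)
Lemma nilN_shift_exp0 (F : fieldType) (d' : nat) (c : F) (r : nat) (j : 'I_d'.+1) :
  (r < j)%N -> ((c%:M + nilN d' F) ^+ r) ord0 j = 0.
Proof.
elim: r j => [|r IH] j lt_rj; first by rewrite expr0 mxE -val_eqE /= ltn_eqF.
rewrite exprSr mxE big1 // => l _; rewrite !mxE -val_eqE /=.
have [lt_rl|le_lr] := ltnP r l; first by rewrite IH // mul0r.
rewrite ltn_eqF; last by apply: leq_trans lt_rj; rewrite ltnS ltnW.
by rewrite gtn_eqF ?addr0 ?mulr0 //; apply: leq_trans lt_rj.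
Qed.

(** The product is [e_(d,1)] times the upper right corner entry of the middle factor, which the band
    of a power below [d'] does not reach. *)
Lemma delta_exp_delta (F : fieldType) (d' : nat) (c : F) (r : nat) : (r < d')%N ->
  delta_mx ord_max ord0 * (c%:M + nilN d' F) ^+ r * delta_mx ord_max ord0 = 0.
Proof.
move=> lt_rd; apply/matrixP => i j.
rewrite -[_ * delta_mx _ _]mulr1 mul_delta_mxE -[delta_mx _ _ in LHS]mul1r.
by rewrite mul_delta_mxE nilN_shift_exp0 // mulr0 mul0r mxE.
Qed.

(** * Coefficient recursions in the skew polynomial ring *)

Lemma skewCM (R : nzRingType) (sigma : {rmorphism R -> R}) (a b : R) :
  skewC (a * b) = skewC a * skewC b :> skewpoly sigma.
Proof.
apply: skewpolyP => n; rewrite skewcoefM /skew_mul big_ord_recl big1 ?addr0.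
  by rewrite !skewcoefC /= subn0; case: eqP; rewrite ?mulr0.
by move=> i _; rewrite skewcoefC mul0r.
Qed.

Lemma skewCB (R : nzRingType) (sigma : {rmorphism R -> R}) (a b : R) :
  skewC (a - b) = skewC a - skewC b :> skewpoly sigma.
Proof. exact: polyCB. Qed.

Lemma skewC0 (R : nzRingType) (sigma : {rmorphism R -> R}) :
  skewC 0 = 0 :> skewpoly sigma.
Proof. exact: polyC0. Qed.

Lemma skew_sum_rec (R : nzRingType) (sigma : {rmorphism R -> R}) (L : R)
    (a b : nat -> R) (n : nat) :
  a n.+1 = 0 -> b 0%N = a 0%N ->
  (forall j, (j <= n)%N -> b j.+1 = a j.+1 - L * sigma (a j)) ->
  \sum_(j < n.+2) skewC (b j) * tau ^+ j
  = (1 - skewC L * tau) * \sum_(j < n.+1) skewC (a j) * tau ^+ j :> skewpoly sigma.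
Proof.
move=> an b0 bS; rewrite mulrBl mul1r mulr_sumr big_ord_recl.
(* Padding by the zero term of index [n.+1] gives the undelayed sum the range of the left-hand
   side. *)
have -> : \sum_(j < n.+1) skewC (a j) * tau ^+ j
    = \sum_(j < n.+2) skewC (a j) * tau ^+ j :> skewpoly sigma.
  by rewrite [RHS]big_ord_recr /= an skewC0 mul0r addr0.
rewrite [in RHS]big_ord_recl -addrA b0; congr (_ + _).
rewrite -sumrB; apply: eq_bigr => j _ /=.
rewrite bS -1?ltnS // skewCB mulrBl; congr (_ - _).
by rewrite exprS -!mulrA [tau * (_ * _)]mulrA tau_skewC skewCM !mulrA.
Qed.

(** * Twists, the exponential relation and the recursion for [bE] *)

Section Factorization.
Variables (Fq : finFieldType) (d' : nat).
Local Notation q := #|Fq|.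
Local Notation K := {fraction {poly Fq}}.
Local Notation M := 'M[K]_d'.+1.
Local Notation Mtau := (skewpoly (@twist1 Fq d')).
Local Notation N := (nilN d' K).
Local Notation e := (delta_mx ord_max ord0 : M).
Local Notation t i := (theta Fq ^+ (q ^ i)).
Local Notation T a := ((t a)%:M + N : M).
Local Notation shiftN := (shiftN Fq d').
Local Notation shift_prod := (shift_prod Fq d').

Lemma twist1_scalar (c : K) : twist1 (c%:M : M) = (c ^+ q)%:M.
Proof. exact: map_scalar_mx. Qed.

Lemma twist1_nilN : twist1 N = N.
Proof.
apply/matrixP => i j; rewrite !mxE.
exact: (rmorph_nat (@frobq Fq)).
Qed.

Lemma twist1_delta : twist1 e = e.
Proof.
apply/matrixP => i j; rewrite !mxE.
exact: (rmorph_nat (@frobq Fq)).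
Qed.

Lemma twist1_T a : twist1 (T a) = T a.+1.
Proof. by rewrite rmorphD /= twist1_scalar twist1_nilN -exprM -expnSr. Qed.

Lemma iter_twist1_thetaN n : iter n (@twist1 Fq d') (thetaN Fq d') = T n.
Proof.
elim: n => [|n IH]; first by rewrite /thetaN expn0 expr1.
by rewrite iterS IH twist1_T.
Qed.

Lemma twist1_shiftN a s : twist1 (shiftN a s) = shiftN a.+1 s.+1.
Proof. by rewrite rmorphB /= twist1_T twist1_scalar -exprM -expnSr. Qed.

Lemma twist1_shift_prod a m n :
  twist1 (shift_prod a m n) = shift_prod a.+1 m.+1 n.+1.
Proof.
rewrite rmorphXn rmorph_prod /= /shift_prod big_add1 /=; congr (_ ^+ _).
by apply: eq_bigr => s _; apply: twist1_shiftN.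
Qed.

Lemma twist1V (A : M) : twist1 A^-1 = (twist1 A)^-1.
Proof. exact: map_invmx. Qed.

Lemma twist_Gamma j k : twist j (Gamma Fq d' k) = (shift_prod j j.+1 (k + j).+1)^-1.
Proof.
rewrite twist_iter GammaE; elim: j => [|j IH]; first by rewrite addn0.
rewrite iterS IH twist1V twist1_shift_prod [(k + j.+1)%N]addnS; reflexivity.
Qed.

Variables (Q : nat -> M) (hQ : is_exp Q).

Lemma exp_shiftN n s :
  Q n.+1 * shiftN n.+1 s = shiftN 0 s * Q n.+1 + e * twist1 (Q n).
Proof.
have [_ /(_ n)] := (is_expE Q).1 hQ.
rewrite iter_twist1_thetaN /thetaN => QT.
have := intertwine_scalar (- t s) QT.
by rewrite raddfN /shiftN expn0 expr1.
Qed.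

(** Only the left factor [e] of the error term matters: in [exp_shiftN_exp] it meets another [e],
    whatever [Z] is. *)
Lemma twist1_exp_shiftN n s : exists Z,
  twist1 (Q n) * shiftN n.+1 s = shiftN 1 s * twist1 (Q n) + e * Z.
Proof.
case: n => [|n].
  exists 0; have [-> _] := (is_expE Q).1 hQ.
  by rewrite rmorph1 mul1r mulr1 mulr0 addr0.
exists (twist1 (twist1 (Q n))).
(* The twist carries the shift by [t 0] to the shift by [t 1]; a further scalar shift then reaches
   an arbitrary [s]. *)
have := congr1 (@twist1 Fq d') (exp_shiftN n 0).
rewrite rmorphD !rmorphM /= !twist1_shiftN twist1_delta.
have C a : shiftN a s = shiftN a 1 + (t 1 - t s)%:M.
  by rewrite /shiftN raddfB /= addrA subrK.
by rewrite !C => QT; apply: intertwine_scalar.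
Qed.

Lemma exp_shiftN_exp n k :
  Q n.+1 * shiftN n.+1 k.+1 ^+ d'.+1
  = shiftN 0 k.+1 ^+ d'.+1 * Q n.+1 + shift_sum Fq d' k * twist1 (Q n).
Proof.
rewrite (intertwine_exp _ (exp_shiftN n k.+1)); congr (_ + _).
rewrite /shift_sum mulr_suml; apply: eq_bigr => m _.
have [Z hZ] := twist1_exp_shiftN n k.+1.
rewrite (intertwine_exp _ hZ) subSS -!mulrA; congr (_ * _).
(* Every error term contains [e * (T_1 - y) ^+ r * e] with [r = m - l.+1 < d'], hence vanishes. *)
rewrite mulrDr mulr_sumr big1 ?addr0 // => l _.
rewrite [e * (_ * _)]mulrA [_ * (e * _)]mulrA shiftNE delta_exp_delta ?mul0r //.
have := ltn_ord m; have := ltn_ord l; lia.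
Qed.

(** The case distinction matters at [j = k.+1]: there the last product is empty, and the formula
    alone would not give the coefficient zero. *)
Definition bE_coef (k j : nat) : M :=
  if (j <= k)%N then shift_prod 0 1 k.+1 * Q j * (shift_prod j j.+1 k.+1)^-1 else 0.

Lemma bE_sum k :
  bE Q k = \sum_(j < k.+1) skewC (bE_coef k j) * tau ^+ j :> Mtau.
Proof.
rewrite /bE mulr_sumr; apply: eq_bigr => j _.
have le_jk : (j <= k)%N by rewrite -ltnS.
by rewrite mulrA -skewCM GammaE invrK twist_Gamma (subnK le_jk) /bE_coef le_jk mulrA.
Qed.

Lemma bE_coef0 k : bE_coef k 0 = 1.
Proof.
have [Q0 _] := (is_expE Q).1 hQ.
by rewrite /bE_coef Q0 mulr1 divrr ?shift_prod_unit.
Qed.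

(** All factors are polynomials in [N], so they commute and the power distributes over the
    product. *)
Lemma shift_prodSr a m n : (m <= n)%N ->
  shift_prod a m n.+1 = shift_prod a m n * shiftN a n ^+ d'.+1.
Proof.
move=> le_mn; rewrite /shift_prod big_nat_recr //=; apply: exprMn_comm.
apply: commr_sym; apply: commr_prod => s _.
rewrite !shiftNE; exact: nilN_shift_comm.
Qed.

(** Puts the coefficient over the denominator of [bE_coef k.+1 j.+1], in the form to which
    [exp_shiftN_exp] applies. *)
Lemma bE_coef_succ k j : (j <= k)%N ->
  bE_coef k j.+1 = shift_prod 0 1 k.+1 * (Q j.+1 * shiftN j.+1 k.+1 ^+ d'.+1)
                     * (shift_prod j.+1 j.+2 k.+2)^-1.
Proof.
rewrite /bE_coef leq_eqVlt => /predU1P[->|lt_jk].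
  (* For [j = k] both sides vanish, because [shiftN k.+1 k.+1] is the nilpotent [N]. *)
  by rewrite ltnn shiftNE subrr raddf0 add0r nilN_nilpotent !mulr0 mul0r.
rewrite lt_jk; apply: mulr_div_factor; first exact: shift_prod_unit.
  by apply: unitrX; apply: shiftN_unit.
exact: shift_prodSr.
Qed.

Lemma bE_coef_rec k j : (j <= k)%N ->
  bE_coef k.+1 j.+1 = bE_coef k j.+1 - calL Fq d' k * twist1 (bE_coef k j).
Proof.
move=> le_jk; rewrite calLE (bE_coef_succ le_jk) /bE_coef ltnS le_jk.
rewrite !rmorphM /= twist1_shift_prod twist1V twist1_shift_prod.
rewrite (@shift_prodSr 0 1 k.+1) //.
apply: coef_rec_identity (exp_shiftN_exp j k).
exact: shift_prod_unit.
Qed.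

Lemma bE_rec k : bE Q k.+1 = (1 - skewC (calL Fq d' k) * tau) * bE Q k :> Mtau.
Proof.
rewrite !bE_sum; apply: skew_sum_rec; last exact: bE_coef_rec.
  by rewrite /bE_coef ltnn.
by rewrite !bE_coef0.
Qed.

End Factorization.

Theorem theoremB (Fq : finFieldType) (d' : nat)
    (Q : nat -> 'M[{fraction {poly Fq}}]_d'.+1) (hQ : is_exp Q) (k : nat) :
  bE Q k = \prod_(i < k) (1 - skewC (calL Fq d' (k - i.+1)) * tau).
Proof.
elim: k => [|k IH]; first by rewrite (bE_sum Q) big_ord1 big_ord0 bE_coef0 // mulr1.
(* The new factor, with [calL k], is leftmost: it is the term [i = 0] of the product. *)
by rewrite (bE_rec hQ) IH big_ord_recl subSS subn0.
Qed.
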